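(* If a map $f:\Gamma\to\Sigma$ of simplicial complexes is a bundle scenario, then $Nf:N\Gamma\to N\Sigma$ is a simplicial scenario.
   Context: A simplicial complex $\Sigma$ has a vertex set $\Sigma_0$ and a set of simplices (also written $\Sigma$): finite subsets of $\Sigma_0$, closed under taking subsets, containing all singletons; $\emptyset$ counts as a simplex. A map $f:\Gamma\to\Sigma$ is a function $\Gamma_0\to\Sigma_0$ with $f(\gamma)=\{f(x):x\in\gamma\}\in\Sigma$ for all $\gamma\in\Gamma$. The star of $\sigma$ is $\mathrm{St}(\sigma)=\{\sigma'\in\Sigma:\sigma\subset\sigma'\}$. A bundle scenario is a map $f:\Gamma\to\Sigma$ of simplicial complexes that is surjective on simplices, locally surjective ($f:\mathrm{St}(\gamma)\to\mathrm{St}(f(\gamma))$ is surjective for every nonempty $\gamma\in\Gamma$), and discrete over vertices ($\{x,y\}\notin\Gamma$ for distinct $x,y\in\Gamma_0$ with $f(x)=f(y)$). A simplicial scenario is a map $g:E\to X$ of simplicial sets that is surjective in each degree, locally surjective (right lifting property with respect to all coface maps $d^i:\Delta[n-1]\to\Delta[n]$, $n\ge1$, $0\le i\le n$), and discrete over vertices (right lifting property with respect to all codegeneracy maps $s^i:\Delta[n]\to\Delta[n-1]$, $n\ge1$, $0\le i\le n-1$). The nerve space $N\Sigma$ is the simplicial set with $(N\Sigma)_n=\{(\sigma_1,\dots,\sigma_n)\in\Sigma^n:\bigcup_i\sigma_i\in\Sigma\}$ ($(N\Sigma)_0=\{()\}$), $d_0$ and $d_n$ deleting the first and the last entry, $d_i$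 for $0<i<n$ replacing $\sigma_i,\sigma_{i+1}$ by $\sigma_i\cup\sigma_{i+1}$, and $s_j$ inserting $\emptyset$ after $\sigma_j$. $(Nf)_n(\gamma_1,\dots,\gamma_n)=(f(\gamma_1),\dots,f(\gamma_n))$. *)

(* Defs.v *)
From mathcomp Require Import all_boot finmap zify.
From mathcomp Require Import boolp.

Set Implicit Arguments.
Unset Strict Implicit.
Unset Printing Implicit Defensive.

Local Open Scope fset_scope.

Record complex := Complex {
  vertex : choiceType;
  simplex : {fset vertex} -> Prop;
  simplex0 : simplex fset0;
  simplex1 : forall x : vertex, simplex [fset x];
  simplexS : forall s t : {fset vertex}, s `<=` t -> simplex t -> simplex s }.

Record complex_map (G S : complex) := ComplexMap {
  vertex_map :> vertex G -> vertex S;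
  vertex_mapP : forall s : {fset vertex G},
    simplex s -> simplex [fset vertex_map x | x in s] }.

Definition star (S : complex) (s t : {fset vertex S}) : Prop :=
  simplex t /\ s `<=` t.

Record bundle_scenario (G S : complex) (f : complex_map G S) : Prop := {
  bundle_surjective : forall s : {fset vertex S}, simplex s ->
    exists2 c : {fset vertex G}, simplex c & [fset f x | x in c] = s;
  bundle_locally_surjective : forall c : {fset vertex G},
    simplex c -> c <> fset0 ->
    forall s : {fset vertex S}, star [fset f x | x in c] s ->
    exists2 c' : {fset vertex G}, star c c' & [fset f x | x in c'] = s;
  bundle_discrete : forall x y : vertex G,
    x <> y -> f x = f y -> ~ simplex [fset x; y] }.

(* Casts into the next larger ordinal: [widen1 i] has value [i] and [succ1 i]
   has value [i.+1], so the simplicial identities are stated with shifted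
   indices, e.g. d_i d_j = d_(j-1) d_i for i < j becomes
   d_i d_(j+1) = d_j d_i for i <= j. *)
Notation widen1 i := (widen_ord (leqnSn _) i).
Notation succ1 i := (lift ord0 i).

Record sset := SSet {
  simp :> nat -> Type;
  face : forall n, 'I_n.+2 -> simp n.+1 -> simp n;
  degen : forall n, 'I_n.+1 -> simp n -> simp n.+1;
  face_face : forall n (i j : 'I_n.+2) (x : simp n.+2), i <= j ->
    face i (face (succ1 j) x) = face j (face (widen1 i) x);
  degen_degen : forall n (i j : 'I_n.+1) (x : simp n), i <= j ->
    degen (widen1 i) (degen j x) = degen (succ1 j) (degen i x);
  face_degen_lt : forall n (i : 'I_n.+2) (j : 'I_n.+1) (x : simp n.+1), i <= j ->
    face (widen1 i) (degen (succ1 j) x) = degen j (face i x);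
  face_degen_same : forall n (i : 'I_n.+1) (x : simp n),
    face (widen1 i) (degen i x) = x;
  face_degen_next : forall n (i : 'I_n.+1) (x : simp n),
    face (succ1 i) (degen i x) = x;
  face_degen_gt : forall n (i : 'I_n.+2) (j : 'I_n.+1) (x : simp n.+1), j < i ->
    face (succ1 i) (degen (widen1 j) x) = degen j (face i x) }.

Record smap (X Y : sset) := SMap {
  smap_fun :> forall n, X n -> Y n;
  smap_face : forall n (i : 'I_n.+2) (x : X n.+1),
    smap_fun (face i x) = face i (smap_fun x);
  smap_degen : forall n (i : 'I_n.+1) (x : X n),
    smap_fun (degen i x) = degen i (smap_fun x) }.
Arguments smap_fun {X Y} _ {n} _.

Definition right_lifting (A B E X : sset) (i : smap A B) (g : smap E X) : Prop :=
  forall (u : smap A E) (v : smap B X),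
    (forall n (a : A n), g n (u n a) = v n (i n a)) ->
  exists w : smap B E,
    (forall n (a : A n), w n (i n a) = u n a) /\
    (forall n (b : B n), g n (w n b) = v n b).

Definition monotone m n (t : {ffun 'I_m -> 'I_n}) : bool :=
  [forall i : 'I_m, forall j : 'I_m, (i <= j) ==> (t i <= t j)].

Definition monotone_map m n := {t : {ffun 'I_m -> 'I_n} | monotone t}.

Lemma monotone_mapP m n (t : monotone_map m n) (i j : 'I_m) :
  i <= j -> val t i <= val t j.
Proof.
by move=> ij; have /forallP/(_ i)/forallP/(_ j)/implyP/(_ ij) := valP t.
Qed.

Lemma monotone_finfun m n (t : 'I_m -> 'I_n) :
  (forall i j : 'I_m, i <= j -> t i <= t j) -> monotone (finfun t).
Proof.
move=> tP; apply/forallP => i; apply/forallP => j; apply/implyP => ij.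
by rewrite !ffunE; apply: tP.
Qed.

Definition monotone_comp m n p (t : monotone_map n p) (u : monotone_map m n) :
  monotone_map m p :=
  Sub (finfun (fun i => val t (val u i)))
      (monotone_finfun (fun i j ij => monotone_mapP t (monotone_mapP u ij))).

Lemma monotone_compA m n p q (t : monotone_map p q) (u : monotone_map n p)
    (v : monotone_map m n) :
  monotone_comp (monotone_comp t u) v = monotone_comp t (monotone_comp u v).
Proof. by apply: val_inj; apply/ffunP => i; rewrite !ffunE. Qed.

Lemma coface_subproof n (i : 'I_n.+1) (j k : 'I_n) :
  j <= k -> lift i j <= lift i k.
Proof. by rewrite /= /bump; lia. Qed.

Definition coface n (i : 'I_n.+1) : monotone_map n n.+1 :=
  Sub (finfun (lift i)) (monotone_finfun (@coface_subproof n i)).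

Lemma codegen_ord_subproof n (i : 'I_n) (j : 'I_n.+1) : unbump i j < n.
Proof. by have := ltn_ord i; have := ltn_ord j; rewrite /unbump; lia. Qed.

Definition codegen_ord n (i : 'I_n) (j : 'I_n.+1) : 'I_n :=
  Ordinal (codegen_ord_subproof i j).

Lemma codegen_subproof n (i : 'I_n) (j k : 'I_n.+1) :
  j <= k -> codegen_ord i j <= codegen_ord i k.
Proof. by rewrite /= /unbump; lia. Qed.

Definition codegen n (i : 'I_n) : monotone_map n.+1 n :=
  Sub (finfun (codegen_ord i)) (monotone_finfun (@codegen_subproof n i)).

Section StandardSimplex.
Variable n : nat.

Let D m := monotone_map m.+1 n.+1.
Let Dface m (i : 'I_m.+2) (t : D m.+1) : D m := monotone_comp t (coface i).
Let Ddegen m (i : 'I_m.+1) (t : D m) : D m.+1 := monotone_comp t (codegen i).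

Ltac simplicial_identity :=
  rewrite /Dface /Ddegen; apply: val_inj; apply/ffunP => k;
  rewrite !ffunE; f_equal; apply: val_inj;
  rewrite /= ?/bump ?/unbump; lia.

Let Dface_face m (i j : 'I_m.+2) (t : D m.+2) : i <= j ->
  Dface i (Dface (succ1 j) t) = Dface j (Dface (widen1 i) t).
Proof. by move=> ij; simplicial_identity. Qed.

Let Ddegen_degen m (i j : 'I_m.+1) (t : D m) : i <= j ->
  Ddegen (widen1 i) (Ddegen j t) = Ddegen (succ1 j) (Ddegen i t).
Proof. by move=> ij; simplicial_identity. Qed.

Let Dface_degen_lt m (i : 'I_m.+2) (j : 'I_m.+1) (t : D m.+1) : i <= j ->
  Dface (widen1 i) (Ddegen (succ1 j) t) = Ddegen j (Dface i t).
Proof. by move=> ij; simplicial_identity. Qed.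

Let Dface_degen_same m (i : 'I_m.+1) (t : D m) :
  Dface (widen1 i) (Ddegen i t) = t.
Proof. by simplicial_identity. Qed.

Let Dface_degen_next m (i : 'I_m.+1) (t : D m) :
  Dface (succ1 i) (Ddegen i t) = t.
Proof. by simplicial_identity. Qed.

Let Dface_degen_gt m (i : 'I_m.+2) (j : 'I_m.+1) (t : D m.+1) : j < i ->
  Dface (succ1 i) (Ddegen (widen1 j) t) = Ddegen j (Dface i t).
Proof. by move=> ij; simplicial_identity. Qed.

Definition Delta : sset :=
  SSet Dface_face Ddegen_degen Dface_degen_lt Dface_degen_same
    Dface_degen_next Dface_degen_gt.

End StandardSimplex.

Definition Delta_map m n (t : monotone_map m.+1 n.+1) : smap (Delta m) (Delta n) :=
  @SMap (Delta m) (Delta n)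
    (fun p (u : monotone_map p.+1 m.+1) => monotone_comp t u)
    (fun p i u => esym (monotone_compA t u (coface i)))
    (fun p i u => esym (monotone_compA t u (codegen i))).

Record simplicial_scenario (E X : sset) (g : smap E X) : Prop := {
  scenario_surjective : forall n (x : X n), exists e : E n, g n e = x;
  scenario_locally_surjective : forall n (i : 'I_n.+2),
    right_lifting (Delta_map (coface i) : smap (Delta n) (Delta n.+1)) g;
  scenario_discrete : forall n (i : 'I_n.+1),
    right_lifting (Delta_map (codegen i) : smap (Delta n.+1) (Delta n)) g }.

Section FaceSeq.
Variable T : choiceType.
Implicit Types (s : seq {fset T}) (i j : nat).

(* Entries are numbered from 1 in the mathematical convention, so the entries
   merged by the inner face [i] are those at positions [i.-1] and [i] here. *)
Definition face_seq i s : seq {fset T} :=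
  if i == 0 then behead s
  else if i == size s then take i.-1 s
  else take i.-1 s ++ (nth fset0 s i.-1 `|` nth fset0 s i) :: drop i.+1 s.

Definition degen_seq i s : seq {fset T} := take i s ++ fset0 :: drop i s.

Definition union_seq s : {fset T} := \bigcup_(x <- s) x.

Lemma size_face_seq i s : i <= size s -> size (face_seq i s) = (size s).-1.
Proof.
rewrite /face_seq => le_is; case: eqP => [_|i0]; first by rewrite size_behead.
case: eqP => [->|ns]; rewrite ?size_cat /= size_takel ?size_drop; lia.
Qed.

Lemma size_degen_seq i s : i <= size s -> size (degen_seq i s) = (size s).+1.
Proof.
move=> le_is; rewrite /degen_seq size_cat /= size_takel // size_drop; lia.
Qed.

Lemma nth_face_seq i s k : i <= size s -> k < (size s).-1 ->
  nth fset0 (face_seq i s) k =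
  if k.+1 < i then nth fset0 s k
  else if k.+1 == i then nth fset0 s k `|` nth fset0 s k.+1
  else nth fset0 s k.+1.
Proof.
move=> le_is lt_ks; rewrite /face_seq; case: eqP => [->|i0].
  by rewrite nth_behead.
case: eqP => [is_|ns].
  by rewrite nth_take; [case: ifP => //; lia|lia].
rewrite nth_cat size_takel; last lia.
case: ifP => h1; case: ifP => h2; try lia; first by rewrite nth_take.
case: eqP => [ki|ki].
  have -> : k - i.-1 = 0 by lia.
  by rewrite /= -ki.
have -> : k - i.-1 = (k - i).+1 by lia.
by rewrite /= nth_drop; congr nth; lia.
Qed.

Lemma nth_degen_seq i s k : i <= size s ->
  nth fset0 (degen_seq i s) k =
  if k < i then nth fset0 s k else if k == i then fset0 else nth fset0 s k.-1.
Proof.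
move=> le_is; rewrite /degen_seq nth_cat size_takel //.
case: ifP => h1; first by rewrite nth_take.
case: eqP => [->|ki]; first by rewrite subnn.
have -> : k - i = (k - i.+1).+1 by lia.
by rewrite /= nth_drop; congr nth; lia.
Qed.

Lemma union_seqS s t :
  (forall x, x \in s -> x `<=` union_seq t) -> union_seq s `<=` union_seq t.
Proof. by move=> h; apply/bigfcupsP => x xs _; apply: h. Qed.

Lemma nth_union_seq s k : nth fset0 s k `<=` union_seq s.
Proof.
have [lt_ks|le_sk] := ltnP k (size s); last by rewrite nth_default.
exact: bigfcup_sup (mem_nth _ lt_ks) isT.
Qed.

Lemma union_face_seq i s : i <= size s ->
  union_seq (face_seq i s) `<=` union_seq s.
Proof.
move=> le_is; apply: union_seqS => x /(nthP fset0)[k].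
rewrite size_face_seq // => lt_k <-; rewrite nth_face_seq //.
by do 2?[case: ifP => _]; rewrite ?fsubUset !nth_union_seq.
Qed.

Lemma union_degen_seq i s : i <= size s ->
  union_seq (degen_seq i s) `<=` union_seq s.
Proof.
move=> le_is; apply: union_seqS => x /(nthP fset0)[k] _ <-.
rewrite nth_degen_seq //; do 2?[case: ifP => _]; rewrite ?nth_union_seq //.
Qed.

End FaceSeq.

Section Nerve.
Variable S : complex.
Implicit Types s : seq {fset vertex S}.

Definition nerve_pred s : Prop :=
  (forall x, x \in s -> simplex x) /\ simplex (union_seq s).

Definition nerve_simp n := {t : n.-tuple {fset vertex S} | nerve_pred t}.

Lemma nerve_predP s : simplex (union_seq s) -> nerve_pred s.
Proof.
move=> sU; split=> // x xs; apply: simplexS sU.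
exact: bigfcup_sup xs isT.
Qed.

Lemma nerve_face_tupleP n (i : 'I_n.+2) (t : n.+1.-tuple {fset vertex S}) :
  size (face_seq i t) == n.
Proof. by rewrite size_face_seq size_tuple // -ltnS. Qed.

Lemma nerve_degen_tupleP n (i : 'I_n.+1) (t : n.-tuple {fset vertex S}) :
  size (degen_seq i t) == n.+1.
Proof. by rewrite size_degen_seq size_tuple // -ltnS. Qed.

Lemma nerve_faceP n (i : 'I_n.+2) (x : nerve_simp n.+1) :
  nerve_pred (Tuple (nerve_face_tupleP i (sval x))).
Proof.
case: x => t [_ tU] /=; apply: nerve_predP; apply: simplexS tU.
by apply: union_face_seq; rewrite size_tuple -ltnS.
Qed.

Lemma nerve_degenP n (i : 'I_n.+1) (x : nerve_simp n) :
  nerve_pred (Tuple (nerve_degen_tupleP i (sval x))).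
Proof.
case: x => t [_ tU] /=; apply: nerve_predP; apply: simplexS tU.
by apply: union_degen_seq; rewrite size_tuple -ltnS.
Qed.

Definition nerve_face n (i : 'I_n.+2) (x : nerve_simp n.+1) : nerve_simp n :=
  exist _ (Tuple (nerve_face_tupleP i (sval x))) (nerve_faceP i x).

Definition nerve_degen n (i : 'I_n.+1) (x : nerve_simp n) : nerve_simp n.+1 :=
  exist _ (Tuple (nerve_degen_tupleP i (sval x))) (nerve_degenP i x).

Lemma nerve_simp_eq n (x y : nerve_simp n) :
  (forall k, k < n -> nth fset0 (sval x) k = nth fset0 (sval y) k) -> x = y.
Proof.
case: x y => [t tP] [u uP] /= tu; apply: eq_exist; apply: val_inj => /=.
by apply: (@eq_from_nth _ fset0) => [|k]; rewrite !size_tuple // => /tu.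
Qed.

Lemma nth_nerve_face n (i : 'I_n.+2) (x : nerve_simp n.+1) k :
  nth fset0 (sval (nerve_face i x)) k =
  if n <= k then fset0
  else if k.+1 < i then nth fset0 (sval x) k
  else if k.+1 == i then nth fset0 (sval x) k `|` nth fset0 (sval x) k.+1
  else nth fset0 (sval x) k.+1.
Proof.
case: (leqP n k) => [nk|kn]; first by rewrite nth_default ?size_tuple.
by rewrite nth_face_seq ?size_tuple // -ltnS.
Qed.

Lemma nth_nerve_degen n (i : 'I_n.+1) (x : nerve_simp n) k :
  nth fset0 (sval (nerve_degen i x)) k =
  if k < i then nth fset0 (sval x) k
  else if k == i then fset0 else nth fset0 (sval x) k.-1.
Proof. by rewrite nth_degen_seq ?size_tuple // -ltnS. Qed.

Ltac nerve_identity :=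
  apply: nerve_simp_eq => k kn;
  rewrite ?(nth_nerve_face, nth_nerve_degen) /= ?/bump;
  repeat (case: ifP => ?; try lia);
  rewrite ?fsetU0 ?fset0U -?fsetUA //;
  repeat (congr fsetU || congr nth); lia.

Lemma nerve_face_face n (i j : 'I_n.+2) (x : nerve_simp n.+2) : i <= j ->
  nerve_face i (nerve_face (succ1 j) x) = nerve_face j (nerve_face (widen1 i) x).
Proof. by move=> ij; have jn := ltn_ord j; nerve_identity. Qed.

Lemma nerve_degen_degen n (i j : 'I_n.+1) (x : nerve_simp n) : i <= j ->
  nerve_degen (widen1 i) (nerve_degen j x) = nerve_degen (succ1 j) (nerve_degen i x).
Proof. by move=> ij; have jn := ltn_ord j; nerve_identity. Qed.

Lemma nerve_face_degen_lt n (i : 'I_n.+2) (j : 'I_n.+1) (x : nerve_simp n.+1) :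
  i <= j ->
  nerve_face (widen1 i) (nerve_degen (succ1 j) x) = nerve_degen j (nerve_face i x).
Proof. by move=> ij; have jn := ltn_ord j; nerve_identity. Qed.

Lemma nerve_face_degen_same n (i : 'I_n.+1) (x : nerve_simp n) :
  nerve_face (widen1 i) (nerve_degen i x) = x.
Proof. by have ni := ltn_ord i; nerve_identity. Qed.

Lemma nerve_face_degen_next n (i : 'I_n.+1) (x : nerve_simp n) :
  nerve_face (succ1 i) (nerve_degen i x) = x.
Proof. by have ni := ltn_ord i; nerve_identity. Qed.

Lemma nerve_face_degen_gt n (i : 'I_n.+2) (j : 'I_n.+1) (x : nerve_simp n.+1) :
  j < i ->
  nerve_face (succ1 i) (nerve_degen (widen1 j) x) = nerve_degen j (nerve_face i x).
Proof. by move=> ij; have jn := ltn_ord j; nerve_identity. Qed.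

Definition nerve : sset :=
  SSet nerve_face_face nerve_degen_degen nerve_face_degen_lt
    nerve_face_degen_same nerve_face_degen_next nerve_face_degen_gt.

End Nerve.

Section NerveMap.
Variables (G S : complex) (f : complex_map G S).

Let im (c : {fset vertex G}) : {fset vertex S} := [fset f x | x in c].

Lemma nerve_mapP n (x : nerve_simp G n) :
  nerve_pred (map_tuple im (sval x)).
Proof.
case: x => t [_ tU] /=; apply: nerve_predP.
apply: simplexS (vertex_mapP f tU); apply/bigfcupsP => y /mapP[c ct ->] _.
apply/fsubsetP => _ /imfsetP[z /= zc ->]; apply/imfsetP; exists z => //=.
exact: (fsubsetP (bigfcup_sup _ ct isT)).
Qed.

Definition nerve_map_fun n (x : nerve G n) : nerve S n :=
  exist _ (map_tuple im (sval x)) (nerve_mapP x).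

Lemma nth_nerve_map n (x : nerve G n) k :
  nth fset0 (sval (nerve_map_fun x)) k = im (nth fset0 (sval x) k).
Proof.
have im0 : im fset0 = fset0 by apply: imfset0.
have [kn|nk] := ltnP k n; first by rewrite (nth_map fset0) ?size_tuple.
by rewrite !nth_default ?size_map ?size_tuple.
Qed.

Lemma nerve_map_face n (i : 'I_n.+2) (x : nerve G n.+1) :
  nerve_map_fun (face i x) = face i (nerve_map_fun x).
Proof.
apply: nerve_simp_eq => k kn; rewrite nth_nerve_map !nth_nerve_face.
by do 3?[case: ifP => _]; rewrite ?nth_nerve_map // /im ?imfset0 ?imfsetU.
Qed.

Lemma nerve_map_degen n (i : 'I_n.+1) (x : nerve G n) :
  nerve_map_fun (degen i x) = degen i (nerve_map_fun x).
Proof.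
apply: nerve_simp_eq => k kn; rewrite nth_nerve_map !nth_nerve_degen.
by do 2?[case: ifP => _]; rewrite ?nth_nerve_map // /im imfset0.
Qed.

Definition nerve_map : smap (nerve G) (nerve S) :=
  SMap nerve_map_face nerve_map_degen.

End NerveMap.

(* Main.v *)
(* A simplex e of NΓ all of whose entries lie in a simplex c of Γ is determined
   by c and its image under Nf: f is injective on c because it is discrete over
   vertices, so each entry of e is the part of c lying over its image.  To lift
   x in NΣ along a coface, starting from e in NΓ, enlarge the union of e to a
   simplex c lying over the union of x (local surjectivity, or surjectivity when
   the union of e is empty) and take the parts of c over the entries of x.
   Lifting along a codegeneracy only uses that a set with empty image is
   empty. *)
Require Import Defs.
From mathcomp Require Import all_boot finmap zify.

Set Implicit Arguments.
Unset Strict Implicit.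
Unset Printing Implicit Defensive.

Local Open Scope fset_scope.

(** * Monotone maps and the generation of the standard simplex *)

Definition monotone_id n : monotone_map n n :=
  Sub (finfun id) (monotone_finfun (fun (i j : 'I_n) (ij : i <= j) => ij)).

Lemma monotone_map_eq m n (t u : monotone_map m n) :
  (forall i, val t i = val u i :> nat) -> t = u.
Proof. by move=> tu; apply: val_inj; apply/ffunP => i; apply: val_inj; apply: tu. Qed.

Lemma monotone_comp_id m n (t : monotone_map m n) :
  monotone_comp t (monotone_id m) = t.
Proof. by apply: monotone_map_eq => i; rewrite !ffunE. Qed.

Lemma monotone_id_comp m n (t : monotone_map m n) :
  monotone_comp (monotone_id n) t = t.
Proof. by apply: monotone_map_eq => i; rewrite !ffunE. Qed.

(** Away from the missed value [i], [unbump i] inverts the coface, so [t'] is [t] followed by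
    [unbump i]. *)
Lemma monotone_coface_factor m n (t : monotone_map m n.+2) (i : 'I_n.+2) :
  (forall k, val t k != i) -> exists t' : monotone_map m n.+1,
    t = monotone_comp (coface i) t'.
Proof.
move=> ti.
have tlt k : unbump i (val t k) < n.+1.
  move: (ti k) (ltn_ord i); rewrite -val_eqE; move: (val t k) => j.
  by have := ltn_ord j; rewrite /= /unbump; lia.
have tmono (j k : 'I_m) : j <= k -> Ordinal (tlt j) <= Ordinal (tlt k).
  by move=> /(monotone_mapP t) /=; rewrite /unbump; lia.
exists (Sub (finfun (fun k => Ordinal (tlt k))) (monotone_finfun tmono)).
apply: monotone_map_eq => k; rewrite !ffunE /=.
move: (ti k); rewrite -val_eqE; move: (val t k) => j.
by rewrite /= /bump /unbump; lia.
Qed.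

(** The codegeneracy followed by the coface fixes every index except [k], which it sends to [k.+1],
    where [t] takes the same value. *)
Lemma monotone_degen m n (t : monotone_map m.+2 n) (k : 'I_m.+1) :
  val t (widen1 k) = val t (succ1 k) ->
  t = monotone_comp (monotone_comp t (coface (widen1 k))) (codegen k).
Proof.
move=> tk; apply: monotone_map_eq => i; rewrite !ffunE.
have [ik|ik] := eqVneq (i : nat) k.
  have -> : i = widen1 k by apply: val_inj.
  rewrite tk; congr (nat_of_ord (val t _)); apply: val_inj.
  by rewrite /= /bump /unbump; lia.
congr (nat_of_ord (val t _)); apply: val_inj.
by move: ik; rewrite /= /bump /unbump; lia.
Qed.

Lemma monotone_strict_gap m n (t : monotone_map m.+1 n) :
  (forall k : 'I_m, val t (widen1 k) != val t (succ1 k)) ->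
  forall i j : 'I_m.+1, i <= j -> val t i + (j - i) <= val t j.
Proof.
move=> tS i j; move dE: (j - i) => d; elim: d j dE => [|d IH] j dE ij.
  by rewrite addn0; apply: monotone_mapP.
have jm : j.-1 < m by have := ltn_ord j; lia.
have wE : widen1 (Ordinal jm) = j.-1 :> nat by [].
have sE : succ1 (Ordinal jm) = j by apply: val_inj; rewrite /= /bump; lia.
have := IH (widen1 (Ordinal jm)).
have := tS (Ordinal jm); rewrite sE -val_eqE /= => tn.
have : val t (widen1 (Ordinal jm)) <= val t j.
  by apply: monotone_mapP; rewrite wE; lia.
by move: tn; rewrite /=; lia.
Qed.

(** The gap bound between the end points gives [m <= n], and counting values gives [n <= m]. The
    bounds from [0] to [k] and from [k] to the end then pin down [t k]. *)
Lemma monotone_strict_surj m n (t : monotone_map m.+1 n.+1) :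
  (forall k : 'I_m, val t (widen1 k) != val t (succ1 k)) ->
  (forall i, exists k, val t k = i) ->
  m = n /\ forall k, val t k = k :> nat.
Proof.
move=> /monotone_strict_gap gap tE.
have lt k : val t k < n.+1 := ltn_ord _.
have mn : m <= n by have := gap ord0 ord_max isT; have := lt ord_max; rewrite /=; lia.
have nm : n <= m.
  have : #|'I_n.+1| <= #|codom (val t)|.
    apply: subset_leq_card; apply/subsetP => x _.
    by have [k <-] := tE x; apply: codom_f.
  by move=> /leq_trans/(_ (leq_image_card _ _)); rewrite !card_ord.
split; first lia.
move=> k; have km := ltn_ord k.
have := gap ord0 k isT; have := gap k ord_max; have := lt ord_max.
by rewrite /=; lia.
Qed.

(* A face of t deletes and a degeneracy repeats an entry: a repeated entry is
   removed by induction on m, a missing value by factoring t through a coface and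
   induction on n, and what remains is the identity. *)
Lemma Delta_ind n (P : forall m, Delta n m -> Prop) :
  P n (monotone_id n.+1) ->
  (forall m (i : 'I_m.+2) (t : Delta n m.+1), P m.+1 t -> P m (face i t)) ->
  (forall m (i : 'I_m.+1) (t : Delta n m), P m t -> P m.+1 (degen i t)) ->
  forall m (t : Delta n m), P m t.
Proof.
elim: n P => [|n IHn] P P1 Pface Pdegen m t.
  elim: m t => [|m IHm] t.
    suff -> : t = monotone_id 1 by [].
    by apply: monotone_map_eq => i; rewrite !ord1.
  (* All values in ['I_1] agree, so every simplex of positive degree is degenerate. *)
  rewrite (@monotone_degen _ _ t ord0) ?ord1 //.
  by apply: Pdegen; apply: IHm.
have Pmiss p (s : Delta n.+1 p) (i : 'I_n.+2) : (forall k, val s k != i) -> P p s.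
  move=> /monotone_coface_factor[{}s ->].
  (* Transport [P] along the coface; the base case holds because [coface i] is the [i]-th face of
     the identity. *)
  apply: (IHn (fun q r => P q (monotone_comp (coface i) r))) => [|q j r Pr|q j r Pr].
  - by rewrite monotone_comp_id -(monotone_id_comp (coface i)); apply: Pface.
  - by rewrite -[X in P _ X]monotone_compA; apply: Pface.
  - by rewrite -[X in P _ X]monotone_compA; apply: Pdegen.
elim: m t => [|m IHm] t.
  (* A vertex takes one value only, so it misses [ord0] or [ord_max]. *)
  apply: (Pmiss _ _ (if val t ord0 == ord0 then ord_max else ord0)) => k.
  by rewrite ord1; case: ifP => [/eqP ->|->].
have [/existsP[k /eqP /monotone_degen ->]|/existsPn tS] :=
    boolP [exists k : 'I_m.+1, val t (widen1 k) == val t (succ1 k)].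
  by apply: Pdegen; apply: IHm.
have [/existsP[i /forallP /Pmiss //]|/existsPn tE] :=
    boolP [exists i, forall k, val t k != i].
have [|[mn] tid] := monotone_strict_surj tS.
  by move=> i; have /forallPn[k /negPn/eqP] := tE i; exists k.
subst m; suff -> : t = monotone_id n.+2 by [].
by apply: monotone_map_eq => k; rewrite tid ffunE.
Qed.

(** * Maps out of a standard simplex and the Yoneda lemma for nerves *)

Lemma Delta_ext n (X : sset) (u v : smap (Delta n) X) :
  u n (monotone_id n.+1) = v n (monotone_id n.+1) ->
  forall m (t : Delta n m), u m t = v m t.
Proof.
move=> uv; apply: Delta_ind => // m i t E.
- by rewrite !smap_face E.
- by rewrite !smap_degen E.
Qed.

Definition smap_comp (X Y Z : sset) (g : smap Y Z) (h : smap X Y) : smap X Z.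
Proof.
refine (@SMap X Z (fun n x => g n (h n x)) _ _) => n i x.
- by rewrite !smap_face.
- by rewrite !smap_degen.
Defined.

(* Entry k of the simplex t^* x is the union of the entries of x strictly after
   vertex t k up to vertex t (k+1), so the map Delta n -> nerve S classifying x
   has an explicit form; a general simplicial set would need the epi-mono
   factorization of t. *)
Section NerveYoneda.
Variables (S : complex) (n : nat) (x : nerve S n).

Definition spine_interval a b : {fset vertex S} :=
  \bigcup_(j <- index_iota a b) nth fset0 (sval x) j.

Lemma spine_interval_cat a b c : a <= b -> b <= c ->
  spine_interval a c = spine_interval a b `|` spine_interval b c.
Proof. exact: big_cat_nat. Qed.

Definition yoneda_seq m (t : Delta n m) : m.-tuple {fset vertex S} :=
  [tuple spine_interval (val t (widen1 k)) (val t (succ1 k)) | k < m].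

Lemma yoneda_seqP m (t : Delta n m) : nerve_pred (yoneda_seq t).
Proof.
apply: nerve_predP; apply: simplexS (svalP x).2.
apply/bigfcupsP => _ /mapP[k _ ->] _.
by apply/bigfcupsP => j _ _; apply: nth_union_seq.
Qed.

Definition yoneda_fun m (t : Delta n m) : nerve S m :=
  exist _ (yoneda_seq t) (yoneda_seqP t).

Lemma nth_yoneda m (t : Delta n m) k : k < m ->
  nth fset0 (sval (yoneda_fun t)) k =
  spine_interval (val t (inord k)) (val t (inord k.+1)).
Proof.
move=> km; rewrite -[k]/(nat_of_ord (Ordinal km)) -tnth_nth tnth_mktuple.
by congr (spine_interval (val t _) (val t _)); apply: val_inj;
  rewrite /= inordK //; lia.
Qed.

Lemma yoneda_face m (i : 'I_m.+2) (t : Delta n m.+1) :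
  yoneda_fun (face i t) = face i (yoneda_fun t).
Proof.
have tE k : k < m.+1 -> val (face i t) (inord k) = val t (inord (bump i k)).
  move=> km; rewrite !ffunE; congr (val t _); apply: val_inj.
  by rewrite /= !inordK // /bump; lia.
apply: nerve_simp_eq => k km.
rewrite nth_yoneda // !tE; try lia.
rewrite nth_nerve_face leqNgt km !nth_yoneda; try lia.
have [ki|ki|ki] := ltngtP k.+1 i; rewrite [if ~~ true then _ else _]/=.
- by congr (spine_interval (val t (inord _)) (val t (inord _))); rewrite /bump; lia.
- by congr (spine_interval (val t (inord _)) (val t (inord _))); rewrite /bump; lia.
(* Here [k.+1 = i]: the inner face merges two adjacent intervals, which meet at vertex [i]. *)
- rewrite -spine_interval_cat; try by apply: monotone_mapP; rewrite !inordK; lia.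
  by congr (spine_interval (val t (inord _)) (val t (inord _))); rewrite /bump; lia.
Qed.

Lemma yoneda_degen m (i : 'I_m.+1) (t : Delta n m) :
  yoneda_fun (degen i t) = degen i (yoneda_fun t).
Proof.
have im := ltn_ord i.
have tE k : k < m.+2 -> val (degen i t) (inord k) = val t (inord (unbump i k)).
  move=> km; rewrite !ffunE; congr (val t _); apply: val_inj.
  by rewrite /= /unbump !inordK; lia.
apply: nerve_simp_eq => k km.
rewrite nth_yoneda // !tE; try lia.
rewrite nth_nerve_degen.
have [ki|ki|ki] := ltngtP k i; rewrite ?nth_yoneda; try lia.
- by congr (spine_interval (val t (inord _)) (val t (inord _))); rewrite /unbump; lia.
- by congr (spine_interval (val t (inord _)) (val t (inord _))); rewrite /unbump; lia.
(* Here [k = i]: vertices [i] and [i.+1] have the same image under the codegeneracy, so the interval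
   is empty. *)
- rewrite /spine_interval big_geq //; apply: eq_leq.
  by congr (nat_of_ord (val t (inord _))); rewrite /unbump; lia.
Qed.

Definition yoneda : smap (Delta n) (nerve S) := SMap yoneda_face yoneda_degen.

Lemma yoneda_id : yoneda n (monotone_id n.+1) = x.
Proof.
apply: nerve_simp_eq => k kn; rewrite nth_yoneda // !ffunE !inordK; try lia.
exact: big_nat1.
Qed.

End NerveYoneda.

(** By [Delta_ext], both triangles commute once they do on the identity, so a lifting problem
    concerns single simplices: [e] stands for [u], and [yoneda y] is the lift. *)
Lemma right_lifting_nerve m n (t : monotone_map m.+1 n.+1) (S : complex)
    (X : sset) (g : smap (nerve S) X) :
  (forall (e : nerve S m) (v : smap (Delta n) X), g m e = v m t ->
   exists y : nerve S n, yoneda y m t = e /\ g n y = v n (monotone_id n.+1)) ->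
  right_lifting (Delta_map t) g.
Proof.
move=> lift u v uv.
have [|y [yt gy]] := lift (u m (monotone_id m.+1)) v.
  by rewrite uv /= monotone_comp_id.
exists (yoneda y); split=> p.
- apply: (@Delta_ext _ _ (smap_comp (yoneda y) (Delta_map t)) u).
  by rewrite -yt /= monotone_comp_id.
- by apply: (@Delta_ext _ _ (smap_comp g (yoneda y)) v); rewrite -gy;
  exact: congr1 (yoneda_id y).
Qed.

(** * Parts of a fixed simplex lying over the entries of a nerve simplex *)

Section Restrict.
Variables (G S : complex) (f : complex_map G S) (c : {fset vertex G}).
Hypothesis sc : simplex c.

Let over (s : {fset vertex S}) : {fset vertex G} := [fset z in c | f z \in s].

Lemma nerve_restrictP n (x : nerve S n) : nerve_pred (map_tuple over (sval x)).
Proof.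
apply: nerve_predP; apply: simplexS sc; apply/bigfcupsP => _ /mapP[s _ ->] _.
exact: fset_sub.
Qed.

Definition nerve_restrict n (x : nerve S n) : nerve G n :=
  exist _ (map_tuple over (sval x)) (nerve_restrictP x).

Lemma nth_nerve_restrict n (x : nerve S n) k :
  nth fset0 (sval (nerve_restrict x)) k = over (nth fset0 (sval x) k).
Proof.
have [kn|nk] := ltnP k n; first by rewrite (nth_map fset0) ?size_tuple.
rewrite !nth_default ?size_map ?size_tuple //.
by apply/fsetP => z; rewrite !inE andbF.
Qed.

Lemma nerve_restrict_face n (i : 'I_n.+2) (x : nerve S n.+1) :
  nerve_restrict (face i x) = face i (nerve_restrict x).
Proof.
apply: nerve_simp_eq => k kn; rewrite nth_nerve_restrict !nth_nerve_face leqNgt kn /=.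
do 2?[case: ifP => _]; rewrite ?nth_nerve_restrict //.
by apply/fsetP => z; rewrite !inE andb_orr.
Qed.

Lemma nerve_map_restrict n (x : nerve S n) :
  union_seq (sval x) `<=` [fset f z | z in c] ->
  nerve_map f n (nerve_restrict x) = x.
Proof.
move=> xc; apply: nerve_simp_eq => k kn.
rewrite nth_nerve_map nth_nerve_restrict; apply/fsetP => y.
apply/imfsetP/idP => [[z /= + ->]|yk]; first by rewrite !inE => /andP[].
have /imfsetP[z /= zc yz] := fsubsetP xc _ (fsubsetP (nth_union_seq _ k) _ yk).
by exists z => //=; rewrite !inE zc -yz.
Qed.

Lemma nerve_restrict_map n (e : nerve G n) :
  {in c &, injective f} -> union_seq (sval e) `<=` c ->
  nerve_restrict (nerve_map f n e) = e.
Proof.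
move=> finj ec; apply: nerve_simp_eq => k kn.
have {}ec : nth fset0 (sval e) k `<=` c := fsubset_trans (nth_union_seq _ k) ec.
rewrite nth_nerve_restrict nth_nerve_map; apply/fsetP => z; rewrite !inE.
apply/andP/idP => [[zc /imfsetP[y /= yk zy]]|zk].
  by rewrite (finj _ _ zc (fsubsetP ec _ yk) zy).
by split; [apply: (fsubsetP ec) | apply/imfsetP; exists z].
Qed.

End Restrict.

Lemma union_nerve_map (G S : complex) (f : complex_map G S) n (e : nerve G n) :
  union_seq (sval (nerve_map f n e)) = [fset f z | z in union_seq (sval e)].
Proof.
apply/fsetP => y; apply/bigfcupP/imfsetP => /=.
  case=> _ /andP[/mapP[s se ->] _] /imfsetP[z /= zs ->].
  by exists z => //; apply/bigfcupP; exists s; rewrite ?se.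
case=> z /bigfcupP[s /andP[se _] zs] ->.
exists [fset f w | w in s]; last by apply/imfsetP; exists z.
by rewrite andbT; apply/mapP; exists s.
Qed.

(** * Lifting simplices along the nerve of a bundle scenario *)

Section BundleScenario.
Variables (G S : complex) (f : complex_map G S).
Hypothesis bf : bundle_scenario f.

(** Any two vertices of [c] span a face of [c], which discreteness forbids when they are distinct
    with equal images. *)
Lemma bundle_inj_in (c : {fset vertex G}) : simplex c -> {in c &, injective f}.
Proof.
move=> sc x y xc yc fxy; apply/eqP; apply/negPn/negP => /eqP xy.
apply: (bundle_discrete bf xy fxy); apply: simplexS sc.
by apply/fsubsetP => z; rewrite !inE => /orP[]/eqP->.
Qed.

Lemma bundle_star_lift (c : {fset vertex G}) (s : {fset vertex S}) :
  simplex c -> star [fset f x | x in c] s ->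
  exists2 c', star c c' & [fset f x | x in c'] = s.
Proof.
move=> sc [ss cs]; have [c0|/eqP c0] := eqVneq c fset0.
  have [c' sc' c's] := bundle_surjective bf ss.
  by exists c' => //; split=> //; rewrite c0 fsub0set.
exact: bundle_locally_surjective.
Qed.

Lemma nerve_map_surjective n (x : nerve S n) : exists e, nerve_map f n e = x.
Proof.
have [c sc cx] := bundle_surjective bf (svalP x).2.
by exists (nerve_restrict f sc x); rewrite nerve_map_restrict ?cx.
Qed.

Lemma nerve_face_lift n (i : 'I_n.+2) (e : nerve G n) (x : nerve S n.+1) :
  nerve_map f n e = face i x ->
  exists y, face i y = e /\ nerve_map f n.+1 y = x.
Proof.
move=> fe.
have [|c [sc ec] cx] := @bundle_star_lift _ (union_seq (sval x)) (svalP e).2.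
  split; first exact: (svalP x).2.
  (* The image of the union of [e] is the union of a face of [x], and a face never enlarges the
     union. *)
  rewrite -union_nerve_map fe.
  by apply: union_face_seq; rewrite size_tuple -ltnS.
exists (nerve_restrict f sc x); split; last by rewrite nerve_map_restrict ?cx.
(* Restriction commutes with faces, so this face of the lift is the restriction of the image of [e],
   hence [e] itself. *)
by rewrite -nerve_restrict_face -fe nerve_restrict_map //; apply: bundle_inj_in.
Qed.

End BundleScenario.

Lemma nerve_degen_lift (G S : complex) (f : complex_map G S) n (i : 'I_n.+1)
    (e : nerve G n.+1) (x : nerve S n) :
  nerve_map f n.+1 e = degen i x ->
  exists y, degen i y = e /\ nerve_map f n y = x.
Proof.
(* The only candidate: this face undoes [degen i]. *)
move=> fe; exists (face (widen1 i) e); split; last first.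
  by rewrite smap_face fe face_degen_same.
have ei : nth fset0 (sval e) i = fset0.
  have fei : [fset f z | z in nth fset0 (sval e) i] = fset0.
    by rewrite -nth_nerve_map [nerve_map_fun f e]fe nth_nerve_degen ltnn eqxx.
  apply/fsetP => z; rewrite inE; apply/negP => zi.
  have : f z \in [fset f w | w in nth fset0 (sval e) i] by apply/imfsetP; exists z.
  by rewrite fei inE.
apply: nerve_simp_eq => k kn; rewrite nth_nerve_degen !nth_nerve_face.
have ni := ltn_ord i; have [ki|ki|-> //] := ltngtP k i.
- rewrite leqNgt (leq_trans ki) //= ltn_neqAle ki andbT.
  (* If [k.+1 = i], the face has merged entry [k] with entry [i], which is empty. *)
  by case: eqVneq => //= ->; rewrite ei fsetU0.
- case: k kn ki => // k kn ik; rewrite /= leqNgt -ltnS kn /=.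
  by rewrite ltnNge ltnW ?gtn_eqF.
Qed.

Theorem proposition4p2 (G S : complex) (f : complex_map G S) :
  bundle_scenario f -> simplicial_scenario (nerve_map f).
Proof.
move=> bf; split=> [n x|n i|n i].
- exact: nerve_map_surjective.
- apply: right_lifting_nerve => e v.
  (* As [coface i] is a face of the identity, [v] sends it to the [i]-th face of the simplex to be
     lifted. *)
  rewrite -(monotone_id_comp (coface i)) smap_face => /(nerve_face_lift bf)[y [ye yv]].
  exists y; split=> //.
  by rewrite (smap_face (yoneda y)) yoneda_id.
- apply: right_lifting_nerve => e v.
  rewrite -(monotone_id_comp (codegen i)) smap_degen => /nerve_degen_lift[y [ye yv]].
  exists y; split=> //.
  by rewrite (smap_degen (yoneda y)) yoneda_id.
Qed.
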